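(* Let $k\ge 6$ and $n=2k$. Let $S_1=\{1,2,2k-2,2k-1\}\subseteq\mathbb{Z}_n$ and $S_2=\{k-2,k-1,k+1,k+2\}\subseteq\mathbb{Z}_n$. Then the circulant graphs $G(\mathbb{Z}_n,S_1)$ and $G(\mathbb{Z}_n,S_2)$ have different inertias.
   Context: For $S\subseteq\mathbb{Z}_n\setminus\{0\}$ with $S=-S$, the circulant graph $G(\mathbb{Z}_n,S)$ has vertex set $\mathbb{Z}_n$, with $i,j$ adjacent iff $j-i\in S$. The inertia of a graph $G$ is the triple $(\pi(G),\nu(G),\delta(G))$, where $\pi(G)$, $\nu(G)$ are the numbers of positive and negative eigenvalues of the adjacency matrix (with multiplicity) and $\delta(G)$ is the multiplicity of $0$ as an eigenvalue. *)

(* Defs.v *)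
From mathcomp Require Import all_boot all_order all_algebra.
From mathcomp Require Import polyrcf.
From mathcomp Require Import reals.
Set Implicit Arguments.
Unset Strict Implicit.
Unset Printing Implicit Defensive.
Import Order.TTheory GRing.Theory Num.Theory.
Local Open Scope ring_scope.

(* 'Z_n is the ring of integers modulo n only for 1 < n. *)
Definition connection_set (n : nat) (S : {set 'Z_n}) : bool :=
  (0 \notin S) && (S == [set - x | x in S]).

Definition circulant (n : nat) (S : {set 'Z_n}) : rel 'Z_n :=
  fun i j => j - i \in S.

Definition adjacency (R : nzRingType) (T : finType) (e : rel T) : 'M[R]_#|T| :=
  \matrix_(i, j) (e (enum_val i) (enum_val j))%:R.

Section Inertia.
Variable R : rcfType.

(* [rootsR p] lists the distinct roots in R of p != 0, and [mup x p] is the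
   multiplicity of x as a root of p. *)
Definition pos_eigenvalues (m : nat) (A : 'M[R]_m) : nat :=
  (\sum_(x <- rootsR (char_poly A) | (0 < x)%R) mup x (char_poly A))%N.

Definition neg_eigenvalues (m : nat) (A : 'M[R]_m) : nat :=
  (\sum_(x <- rootsR (char_poly A) | (x < 0)%R) mup x (char_poly A))%N.

Definition zero_eigenvalues (m : nat) (A : 'M[R]_m) : nat :=
  mup 0 (char_poly A).

Definition inertia (T : finType) (e : rel T) : nat * nat * nat :=
  let A := adjacency R e in
  (pos_eigenvalues A, neg_eigenvalues A, zero_eigenvalues A).

End Inertia.

Definition S1 (k : nat) : {set 'Z_(2 * k)} :=
  [set 1%:R; 2%:R; (2 * k - 2)%:R; (2 * k - 1)%:R].

Definition S2 (k : nat) : {set 'Z_(2 * k)} :=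
  [set (k - 2)%:R; (k - 1)%:R; (k + 1)%:R; (k + 2)%:R].

Lemma circulant_irreflexive (n : nat) (S : {set 'Z_n}) :
  connection_set S -> irreflexive (circulant S).
Proof. by case/andP=> S0 _ i; rewrite /circulant subrr; apply: negbTE. Qed.

Lemma circulant_symmetric (n : nat) (S : {set 'Z_n}) :
  connection_set S -> symmetric (circulant S).
Proof.
case/andP=> _ /eqP SN; suff H i j : circulant S i j -> circulant S j i.
  by move=> i j; apply/idP/idP; apply: H.
by rewrite /circulant => ijS; rewrite SN -opprB imset_f.
Qed.

Lemma natZp_eq0 (n m : nat) : (0 < m < n)%N -> (0 == m%:R :> 'Z_n) = false.
Proof.
case/andP=> m0 mn; have n1 : (1 < n)%N by apply: leq_ltn_trans mn.
by rewrite -val_eqE /= val_Zp_nat // modn_small // eq_sym; case: m m0 {mn}.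
Qed.

Lemma oppZp_nat (n m : nat) :
  (1 < n)%N -> (m <= n)%N -> - m%:R = (n - m)%:R :> 'Z_n.
Proof. by move=> n1 mn; rewrite natrB // pchar_Zp // sub0r. Qed.

Lemma connection_set_S1 (k : nat) : (6 <= k)%N -> connection_set (S1 k).
Proof.
move=> k6; have n12 : (12 <= 2 * k)%N by rewrite (leq_mul2l 2 6).
have n1 : (1 < 2 * k)%N by apply: leq_trans n12.
have n2 : (2 < 2 * k)%N by apply: leq_trans n12.
have ns : (1 <= 2 * k)%N by apply: leq_trans n12.
apply/andP; split.
  by rewrite !inE !natZp_eq0 // ?subn_gt0 ?ltn_subrL ?n1 ?n2 ?ns.
apply/eqP; rewrite /S1 !imsetU !imset_set1 !oppZp_nat ?leq_subr // !subKn //.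
by apply/setP=> x; rewrite !inE -!orbA; do 4!case: (x == _).
Qed.

Lemma connection_set_S2 (k : nat) : (6 <= k)%N -> connection_set (S2 k).
Proof.
move=> k6; have n12 : (12 <= 2 * k)%N by rewrite (leq_mul2l 2 6).
have n1 : (1 < 2 * k)%N by apply: leq_trans n12.
have k2 : (2 < k)%N by apply: leq_trans k6.
have k1 : (1 < k)%N by apply: leq_trans k6.
have E a : (a <= k)%N -> (2 * k - (k - a) = k + a)%N.
  by move=> ak; rewrite mul2n -addnn -addnBA ?leq_subr // subKn.
have F a : (2 * k - (k + a) = k - a)%N by rewrite subnDA mul2n -addnn addnK.
have kn : (k <= 2 * k)%N by rewrite leq_pmull.
have G a : (0 < a < k)%N -> (0 < k - a < 2 * k)%N.
  case/andP=> a0 ak; rewrite subn_gt0 ak.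
  by apply: leq_trans kn; rewrite ltn_subrL a0 (leq_trans _ k1).
have H a : (a < k)%N -> (0 < k + a < 2 * k)%N.
  by move=> ak; rewrite addn_gt0 (leq_trans _ k1) //= mul2n -addnn ltn_add2l.
apply/andP; split; first by rewrite !inE !natZp_eq0 ?G ?H.
apply/eqP; rewrite /S2 !imsetU !imset_set1 !oppZp_nat ?F ?E //;
  do ?[by apply: ltnW | by apply: leq_trans kn; apply: leq_subr
      | by apply: ltnW; case/andP: (H 1%N k1)
      | by apply: ltnW; case/andP: (H 2%N k2)].
by apply/setP=> x; rewrite !inE -!orbA; do 4!case: (x == _).
Qed.

(* Main.v *)
Require Import Defs.
From mathcomp Require Import all_boot all_order all_algebra.
From mathcomp Require Import polyrcf ring lra zify.
From mathcomp Require Import reals trigo.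
Set Implicit Arguments.
Unset Strict Implicit.
Unset Printing Implicit Defensive.
Import Order.TTheory GRing.Theory Num.Theory.
Local Open Scope ring_scope.

(** The Hartley matrix, with entries cos + sin of 2 pi i j / n, is invertible
and diagonalises every symmetric circulant matrix over the reals; the eigenvalue
of index a is the sum of cos (2 pi a s / n) over s in the connection set.  For
n = 2k and c = cos (pi a / k), the first graph has eigenvalues
2 (2c - 1)(c + 1), and those of the second graph are these multiplied by
(-1)^a.  So, among odd a, the positive eigenvalues of the first graph are those
with c > 1/2 and the positive eigenvalues of the second are those with
-1 < c < 1/2, while for even a the two graphs agree.  When k >= 6 there are
strictly more odd a of the second kind. *)

(** * Characteristic polynomials and counting positive eigenvalues *)

(** Over polynomials, [P] intertwines [X - A] and [X - B]; taking determinants and cancelling the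
    nonzero constant [\det P] gives the equality. *)
Lemma char_poly_similar (F : fieldType) (m : nat) (P A B : 'M[F]_m) :
  P \in unitmx -> P *m A = B *m P -> char_poly A = char_poly B.
Proof.
move=> Pu PA; pose Q := map_mx polyC P.
have Qd : \det Q != 0.
  by rewrite det_map_mx polyC_eq0 -unitfE -unitmxE.
apply: (mulfI Qd); rewrite /char_poly [RHS]mulrC -!det_mulmx.
congr (\det _); rewrite /char_poly_mx mulmxBr mulmxBl.
by rewrite -!map_mxM PA scalar_mxC.
Qed.

Lemma mup_prod_XsubC (F : fieldType) (I : finType) (f : I -> F) (x : F) :
  mup x (\prod_i ('X - (f i)%:P)) = (\sum_i (f i == x))%N.
Proof.
have key r : \prod_(i <- r) ('X - (f i)%:P) != 0 /\
    mup x (\prod_(i <- r) ('X - (f i)%:P)) = (\sum_(i <- r) (f i == x))%N.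
  elim: r => [|i r [IH0 IH]].
    rewrite !big_nil oner_neq0 mupNroot //.
    by rewrite rootE hornerC oner_eq0.
  rewrite !big_cons mulf_neq0 ?polyXsubC_eq0 //; split=> //.
  rewrite mupM ?polyXsubC_eq0 // IH; congr (_ + _)%N.
  by rewrite -(expr1 ('X - _)) mup_XsubCX; case: eqP.
exact: (key _).2.
Qed.

(** The sums over roots and over indices are exchanged: index [i] contributes 1 at the root [f i]
    and nothing at any other root. *)
Lemma pos_eigenvalues_prod (R : rcfType) (m : nat) (A : 'M[R]_m)
    (I : finType) (f : I -> R) :
  char_poly A = \prod_i ('X - (f i)%:P) ->
  pos_eigenvalues A = #|[set i | 0 < f i]|.
Proof.
move=> chA; have chN0 : char_poly A != 0 by rewrite monic_neq0 ?char_poly_monic.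
rewrite /pos_eigenvalues; under eq_bigr do rewrite chA mup_prod_XsubC.
rewrite exchange_big /= -sum1_card [RHS]big_mkcond /=; apply: eq_bigr => i _.
have fi : f i \in rootsR (char_poly A).
  rewrite -roots_on_rootsR // inE /= chA.
  by rewrite rootE horner_prod (bigD1 i) //= hornerXsubC subrr mul0r.
rewrite inE big_mkcond (bigD1_seq (f i)) //=; last first.
  exact: lt_sorted_uniq (sorted_roots _ _ _).
rewrite eqxx big1 ?addn0; first by case: ifP.
by move=> x /negbTE xN; rewrite eq_sym xN; case: ifP.
Qed.

Lemma ltn_Zp (n : nat) (x : 'Z_n) : (1 < n)%N -> (x < n)%N.
Proof. by move=> n1; rewrite -[X in (_ < X)%N](Zp_cast n1) ltn_ord. Qed.

Lemma natZp_eq (n p q : nat) : (p < n)%N -> (q < n)%N ->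
  (p%:R == q%:R :> 'Z_n) = (p == q).
Proof.
case: n => [|[|n]] // pn qn.
  by move: pn qn; rewrite !ltnS !leqn0 => /eqP-> /eqP->.
by rewrite -val_eqE /= !val_Zp_nat // !modn_small.
Qed.

(** * Trigonometric functions on residues and the spectrum of a circulant graph *)

Section Characters.
Variables (R : realType) (n : nat).
Hypothesis n_gt1 : (1 < n)%N.
Implicit Types x y a : 'Z_n.

(** The argument is a natural number, so that angles add exactly; reduction modulo [n] only removes
    full turns. *)
Definition angle (m : nat) : R := pi *+ 2 * m%:R / n%:R.
Definition zcos x : R := cos (angle x).
Definition zsin x : R := sin (angle x).

Let n_neq0 : n%:R != 0 :> R.
Proof. by rewrite pnatr_eq0 -lt0n ltnW. Qed.

Lemma angleD p q : angle (p + q) = angle p + angle q.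
Proof. by rewrite /angle natrD; field. Qed.

Lemma angle_mod m : angle m = angle (m %% n) + (pi *+ 2) *+ (m %/ n).
Proof.
rewrite {1}(divn_eq m n) addnC angleD; congr (_ + _).
by rewrite /angle natrM -[RHS]mulr_natr; field.
Qed.

Lemma cos_angle_mod m : cos (angle (m %% n)) = cos (angle m).
Proof. by rewrite (angle_mod m) (periodicn (@cosD2pi R)). Qed.

Lemma sin_angle_mod m : sin (angle (m %% n)) = sin (angle m).
Proof. by rewrite (angle_mod m) (periodicn (@sinD2pi R)). Qed.

Lemma val_ZpD x y : (x + y)%R = ((x + y) %% n)%N :> nat.
Proof. by rewrite /=; congr (_ %% _)%N; apply: Zp_cast. Qed.

Lemma zcos_nat m : zcos m%:R = cos (angle m).
Proof. by rewrite /zcos val_Zp_nat // cos_angle_mod. Qed.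

Lemma zsin_nat m : zsin m%:R = sin (angle m).
Proof. by rewrite /zsin val_Zp_nat // sin_angle_mod. Qed.

Lemma zcosD x y : zcos (x + y) = zcos x * zcos y - zsin x * zsin y.
Proof. by rewrite /zcos val_ZpD cos_angle_mod angleD cosD. Qed.

Lemma zsinD x y : zsin (x + y) = zsin x * zcos y + zcos x * zsin y.
Proof. by rewrite /zsin val_ZpD sin_angle_mod angleD sinD. Qed.

Lemma zcos0 : zcos 0 = 1.
Proof. by rewrite /zcos /angle mulr0 mul0r cos0. Qed.

Lemma zsin0 : zsin 0 = 0.
Proof. by rewrite /zsin /angle mulr0 mul0r sin0. Qed.

Lemma zcos2Dzsin2 x : zcos x ^+ 2 + zsin x ^+ 2 = 1.
Proof. exact: cos2Dsin2. Qed.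

(** The addition formulas at [x + (- x) = 0] are a linear system in [zcos (- x)] and [zsin (- x)]
    with determinant 1, so the representative of [- x] need not be computed. *)
Lemma zcosN x : zcos (- x) = zcos x.
Proof.
have := zcosD x (- x); have := zsinD x (- x); have := zcos2Dzsin2 x.
rewrite subrr zcos0 zsin0; set c := zcos x; set s := zsin x => h1 h2 h3.
have -> : zcos (- x) = zcos (- x) * (c ^+ 2 + s ^+ 2) by rewrite h1 mulr1.
transitivity (c * (c * zcos (- x) - s * zsin (- x)) +
              s * (s * zcos (- x) + c * zsin (- x))); first by ring.
by rewrite -h3 -h2; ring.
Qed.

Lemma zsinN x : zsin (- x) = - zsin x.
Proof.
have := zcosD x (- x); have := zsinD x (- x); have := zcos2Dzsin2 x.
rewrite subrr zcos0 zsin0; set c := zcos x; set s := zsin x => h1 h2 h3.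
have -> : zsin (- x) = zsin (- x) * (c ^+ 2 + s ^+ 2) by rewrite h1 mulr1.
transitivity (c * (s * zcos (- x) + c * zsin (- x)) -
              s * (c * zcos (- x) - s * zsin (- x))); first by ring.
by rewrite -h3 -h2; ring.
Qed.

(** The half angle [t] lies strictly between 0 and pi, and [zcos x = 1 - 2 sin^2 t]. *)
Lemma zcos_lt1 x : x != 0 -> zcos x < 1.
Proof.
move=> xN0; have x0 : (0 < x)%N by rewrite lt0n.
have xn := ltn_Zp x n_gt1.
have np : 0 < n%:R :> R by rewrite ltr0n ltnW.
pose t : R := pi * (x%:R / n%:R).
have s0 : 0 < sin t.
  apply: sin_gt0_pi; rewrite /t mulr_gt0 ?pi_gt0 ?divr_gt0 ?ltr0n ?(ltnW n_gt1) //=.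
  by rewrite gtr_pMr ?pi_gt0 // ltr_pdivrMr // mul1r ltr_nat.
have -> : zcos x = 1 - sin t ^+ 2 *+ 2.
  have -> : zcos x = cos (t *+ 2).
    by rewrite /zcos; congr cos; rewrite /angle /t; field.
  by rewrite cos_mulr2n cos2sin2; ring.
have := exprn_gt0 2 s0; lra.
Qed.

(* Both sums are invariant under x |-> x + 1, i.e. fixed by the rotation with
   cosine zcos a and sine zsin a, which has no nonzero fixed vector. *)
Lemma sum_char a :
  (\sum_x zcos (a * x) = if a == 0 then n%:R else 0) /\ \sum_x zsin (a * x) = 0.
Proof.
have [->|aN0] := eqVneq a 0.
  split; last by rewrite big1 // => x _; rewrite mul0r zsin0.
  under eq_bigr do rewrite mul0r zcos0.
  by rewrite sumr_const card_ord Zp_cast.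
set C := \sum_x zcos _; set S := \sum_x zsin _.
have hC : C = C * zcos a - S * zsin a.
  rewrite {1}/C (reindex_inj (addIr 1)) /= !mulr_suml -sumrB.
  by apply: eq_bigr => x _; rewrite mulrDr mulr1 zcosD.
have hS : S = S * zcos a + C * zsin a.
  rewrite {1}/S (reindex_inj (addIr 1)) /= !mulr_suml -big_split /=.
  by apply: eq_bigr => x _; rewrite mulrDr mulr1 zsinD.
have := zcos_lt1 aN0; have := zcos2Dzsin2 a.
set c := zcos a in hC hS *; set s := zsin a in hC hS * => cs c1.
(* This is the determinant of the linear system that [hC] and [hS] impose on [C] and [S]. *)
have d0 : (1 - c) *+ 2 != 0 by rewrite mulrn_eq0 /= subr_eq0 eq_sym lt_eqF.
have dE : (1 - c) *+ 2 = (1 - c) ^+ 2 + s ^+ 2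
  by transitivity ((c ^+ 2 + s ^+ 2) + 1 - c *+ 2); [rewrite cs | ]; ring.
have hC' : C * (1 - c) = - (S * s) by rewrite mulrBr mulr1 {1}hC; ring.
have hS' : S * (1 - c) = C * s by rewrite mulrBr mulr1 {1}hS; ring.
split; apply: (mulIf d0); rewrite mul0r dE.
  transitivity (C * (1 - c) * (1 - c) + C * s * s); first by ring.
  by rewrite hC' -hS'; ring.
transitivity (S * (1 - c) * (1 - c) + S * s * s); first by ring.
have -> : S * s = - (C * (1 - c)) by rewrite hC' opprK.
by rewrite hS'; ring.
Qed.

Definition zcas x : R := zcos x + zsin x.

Definition hartley : 'M[R]_#|'Z_n| :=
  \matrix_(i, j) zcas (enum_val i * enum_val j).

(** The square is [n] times the identity: the product formula turns each entry into a sum of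
    [zcos ((a - b) * x) + zsin ((a + b) * x)], and only [a = b] survives. *)
Lemma hartley_unit : hartley \in unitmx.
Proof.
suff HH : hartley *m hartley = n%:R%:M.
  have /mulmx1_unit[] // : hartley *m (n%:R^-1 *: hartley) = 1%:M.
  by rewrite -scalemxAr HH scale_scalar_mx mulVf.
apply/matrixP => i j; rewrite !mxE.
under eq_bigr do rewrite !mxE.
pose a := enum_val i; pose b := enum_val j.
transitivity (\sum_(x : 'Z_n) (zcos ((a - b) * x) + zsin ((a + b) * x))).
  rewrite [RHS](reindex_onto enum_val enum_rank) /=; last first.
    by move=> x _; rewrite enum_rankK.
  apply: eq_big => [l|l _]; first by rewrite enum_valK eqxx.
  rewrite /zcas -/a -/b [(a - b) * _]mulrBl [(a + b) * _]mulrDl.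
  by rewrite zcosD zsinD zcosN zsinN (mulrC _ b); ring.
rewrite big_split /= (sum_char _).1 (sum_char _).2 addr0 subr_eq0.
by rewrite (inj_eq enum_val_inj); case: eqP.
Qed.

Definition circulant_eigenvalue (S : {set 'Z_n}) (a : 'Z_n) : R :=
  \sum_(s in S) zcos (a * s).

Lemma sum_zsin_connection (S : {set 'Z_n}) a :
  connection_set S -> \sum_(s in S) zsin (a * s) = 0.
Proof.
case/andP=> _ /eqP SN; set X := (LHS).
suff XN : X = - X by lra.
rewrite /X {1}SN big_imset /=; last by move=> x y _ _; apply: oppr_inj.
by rewrite -sumrN; apply: eq_bigr => s _; rewrite mulrN zsinN.
Qed.

(** Each row of the Hartley matrix is a left eigenvector: after substituting [b - s] for the
    summation index, the addition formulas leave the eigenvalue times [zcas (a * b)], because the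
    sine sum over the symmetric set [S] vanishes. *)
Lemma char_poly_circulant (S : {set 'Z_n}) : connection_set S ->
  char_poly (adjacency R (circulant S)) =
    \prod_a ('X - (circulant_eigenvalue S a)%:P).
Proof.
move=> hS.
pose D : 'rV[R]_#|'Z_n| := \row_i circulant_eigenvalue S (enum_val i).
rewrite (char_poly_similar (B := diag_mx D) hartley_unit).
  rewrite char_poly_trig; last first.
    by apply: is_diag_mx_is_trig; apply: diag_mx_is_diag.
  rewrite [RHS](reindex_onto enum_val enum_rank) /=; last first.
    by move=> x _; rewrite enum_rankK.
  apply: eq_big => [i|i _]; first by rewrite enum_valK eqxx.
  by rewrite !mxE eqxx.
apply/matrixP => i j; rewrite mul_diag_mx !mxE.
under eq_bigr do rewrite !mxE.
pose a := enum_val i; pose b := enum_val j.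
transitivity (\sum_(s in S) zcas (a * (b - s))).
  rewrite [RHS](reindex_inj (inv_inj (subKr b))) [RHS]big_mkcond /=.
  rewrite [RHS](reindex_onto enum_val enum_rank) /=; last first.
    by move=> x _; rewrite enum_rankK.
  apply: eq_big => [l|l _]; first by rewrite enum_valK eqxx.
  rewrite /circulant -/a -/b subKr; case: ifP => _; by rewrite ?mulr1 ?mulr0.
transitivity (\sum_(s in S) (zcos (a * s) * zcas (a * b)
     + zsin (a * s) * (zsin (a * b) - zcos (a * b)))).
  apply: eq_bigr => s _; rewrite /zcas mulrBr zcosD zsinD zcosN zsinN; ring.
by rewrite big_split /= -!mulr_suml sum_zsin_connection // mul0r addr0.
Qed.

End Characters.

Lemma sum_set4 (V : nmodType) (T : finType) (F : T -> V) (a b c d : T) :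
  uniq [:: a; b; c; d] ->
  \sum_(s in [set a; b; c; d]) F s = F a + (F b + (F c + F d)).
Proof.
move=> u; rewrite (eq_bigl (mem [:: a; b; c; d])); last first.
  by move=> x; rewrite !inE -!orbA.
by rewrite -big_uniq //= !big_cons big_nil addr0.
Qed.

(** * Eigenvalues of the two graphs on [2 * k] vertices *)

Section EvenOrder.
Variables (R : realType) (k : nat).
Hypothesis k_ge6 : (6 <= k)%N.
Implicit Type a : 'Z_(2 * k).

Let n_gt1 : (1 < 2 * k)%N. Proof. by lia. Qed.
Let k_gt0 : 0 < k%:R :> R. Proof. by rewrite ltr0n; lia. Qed.
Let k_neq0 : k%:R != 0 :> R. Proof. by rewrite gt_eqF. Qed.

Local Notation ang := (angle R (2 * k)).
Local Notation zcos := (zcos R).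
Local Notation zsin := (zsin R).
Local Notation eigval := (circulant_eigenvalue R).

Lemma angleE j : ang j = pi * (j%:R / k%:R).
Proof. by rewrite /angle natrM; field. Qed.

Lemma cos_natpi j : cos (pi *+ j) = (-1) ^+ j :> R.
Proof.
elim: j => [|j IH]; first by rewrite mulr0n cos0 expr0.
by rewrite mulrSr cosDpi IH exprS mulN1r.
Qed.

Lemma sin_natpi j : sin (pi *+ j) = 0 :> R.
Proof.
elim: j => [|j IH]; first by rewrite mulr0n sin0.
by rewrite mulrSr sinDpi IH oppr0.
Qed.

(** The residue [k] stands for the angle pi, so adding [a * k] turns by [a] half turns. *)
Lemma zcosD_half a x : zcos (a * k%:R + x) = (-1) ^+ a * zcos x.
Proof.
have -> : a * k%:R = (a * k)%:R by rewrite natrM natr_Zp.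
rewrite zcosD // zcos_nat // zsin_nat // angleE.
have -> : pi * ((a * k)%:R / k%:R) = pi *+ a :> R.
  by rewrite natrM -[RHS]mulr_natr; field.
by rewrite cos_natpi sin_natpi mul0r subr0.
Qed.

Lemma zcosM2 a : zcos (a * 2%:R) = zcos a ^+ 2 *+ 2 - 1.
Proof.
rewrite mulr_natr mulr2n zcosD //.
by rewrite -(zcos2Dzsin2 R a); ring.
Qed.

Lemma eigval_S1 a : eigval (S1 k) a = 2 * ((2 * zcos a - 1) * (zcos a + 1)).
Proof.
rewrite /circulant_eigenvalue sum_set4; last first.
  by rewrite /= !inE !natZp_eq //; lia.
have E p : (p <= 2 * k)%N -> zcos (a * (2 * k - p)%:R) = zcos (a * p%:R).
  by move=> hp; rewrite -oppZp_nat // mulrN zcosN.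
by rewrite !E ?zcosM2 ?mulr1; [ring | lia | lia].
Qed.

Lemma eigval_S2 a : eigval (S2 k) a = (-1) ^+ a * eigval (S1 k) a.
Proof.
rewrite eigval_S1 /circulant_eigenvalue sum_set4; last first.
  by rewrite /= !inE !natZp_eq //; lia.
have ED p : zcos (a * (k + p)%:R) = (-1) ^+ a * zcos (a * p%:R).
  by rewrite natrD mulrDr zcosD_half.
have EB p : (p <= k)%N -> zcos (a * (k - p)%:R) = (-1) ^+ a * zcos (a * p%:R).
  by move=> pk; rewrite natrB // mulrBr zcosD_half zcosN.
by rewrite !ED !EB ?zcosM2 ?mulr1; [ring | lia | lia].
Qed.

(** * Comparison of the cosines with 1/2 and -1, and signs of the eigenvalues *)

Lemma cos_angle_sym j : (j <= 2 * k)%N -> cos (ang (2 * k - j)) = cos (ang j).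
Proof.
move=> jk; rewrite -[RHS]cosN -[RHS]cosD2pi; congr cos.
by rewrite !angleE natrB // natrM; field.
Qed.

(** The triple angle formula at [3 x = pi] gives [(c + 1) (2 c - 1)^2 = 0], and [c] is positive. *)
Lemma cos_pi3 : cos (pi / 3) = 2^-1 :> R.
Proof.
set x : R := pi / 3; have := @cospi R.
have -> : pi = x + x *+ 2 by rewrite /x; field.
rewrite cosD sin_mulr2n cos_mulr2n.
have c0 : 0 < cos x.
  by apply: cos_gt0_pihalf; have := @pi_gt0 R; rewrite /x; lra.
have := sin2cos2 x; move: c0; set c := cos x; set s := sin x => c0 sc h.
have : (c + 1) * (2 * c - 1) ^+ 2 = 0.
  transitivity (c * (c ^+ 2 *+ 2 - 1) - (1 - c ^+ 2) * c *+ 2 + 1); first by ring.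
  rewrite -sc.
  transitivity (c * (c ^+ 2 *+ 2 - 1) - s * ((c * s) *+ 2) + 1); first by ring.
  by rewrite h addNr.
move/eqP; rewrite mulf_eq0 sqrf_eq0 => /orP[] /eqP; lra.
Qed.

Lemma angle_itv m : (m <= k)%N -> ang m \in `[0, pi].
Proof.
move=> mk; rewrite angleE in_itv /= mulr_ge0 ?pi_ge0 ?divr_ge0 //=.
by rewrite ger_pMr ?pi_gt0 // ler_pdivrMr // mul1r ler_nat.
Qed.

Lemma ltr_cos_angle i j : (i <= k)%N -> (j <= k)%N ->
  (cos (ang i) < cos (ang j)) = (j < i)%N.
Proof.
move=> ik jk; rewrite ltr_cos ?angle_itv // !angleE.
by rewrite ltr_pM2l ?pi_gt0 // ltr_pM2r ?invr_gt0 // ltr_nat.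
Qed.

Lemma ltr_cos_angle_half j : (j <= k)%N ->
  ((cos (ang j) < 2^-1) = (k < 3 * j)%N) *
  ((2^-1 < cos (ang j)) = (3 * j < k)%N).
Proof.
move=> jk.
have I := angle_itv jk.
have J : pi / 3 \in `[0, pi : R] by rewrite in_itv /=; have := @pi_gt0 R; lra.
rewrite -cos_pi3 !ltr_cos // !angleE !ltr_pM2l ?pi_gt0 //.
rewrite ltr_pdivlMr // ltr_pdivrMr // -!(ltr_nat R) !natrM.
by split; apply/idP/idP; lra.
Qed.

Lemma zcos_gt_half a : (2^-1 < zcos a) = (3 * a < k)%N || (5 * k < 3 * a)%N.
Proof.
have an := ltn_Zp a n_gt1.
(* Cosine is monotone only on [[0, pi]], so indices above [k] are first reflected to [2 * k - a]. *)
rewrite -[zcos a]/(cos (ang a)); have [ak|ka] := leqP a k.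
  by rewrite ltr_cos_angle_half //; lia.
by rewrite -(cos_angle_sym (ltnW an)) ltr_cos_angle_half; lia.
Qed.

Lemma zcos_lt_half a : (zcos a < 2^-1) = (k < 3 * a < 5 * k)%N.
Proof.
have an := ltn_Zp a n_gt1.
rewrite -[zcos a]/(cos (ang a)); have [ak|ka] := leqP a k.
  by rewrite ltr_cos_angle_half //; lia.
by rewrite -(cos_angle_sym (ltnW an)) ltr_cos_angle_half; lia.
Qed.

Lemma zcos_gtN1 a : (-1 < zcos a) = (a != k :> nat).
Proof.
have an := ltn_Zp a n_gt1.
have -> : -1 = cos (ang k) by rewrite angleE divff // mulr1 cospi.
rewrite -[zcos a]/(cos (ang a)); have [ak|ka] := leqP a k.
  by rewrite ltr_cos_angle //; lia.
by rewrite -(cos_angle_sym (ltnW an)) ltr_cos_angle; lia.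
Qed.

Lemma eigval_S1_gt0 a :
  (0 < eigval (S1 k) a) = (3 * a < k)%N || (5 * k < 3 * a)%N.
Proof.
rewrite eigval_S1 -zcos_gt_half pmulr_rgt0 //.
have := cos_geN1 (ang a); rewrite -/(zcos a); set c := zcos a => c1.
by apply/idP/idP => h; nra.
Qed.

(** The factor [zcos a + 1] is nonnegative and vanishes exactly at [a = k], which lies inside the
    arc and has eigenvalue 0. *)
Lemma eigval_S1_lt0 a :
  (eigval (S1 k) a < 0) = (k < 3 * a < 5 * k)%N && (a != k :> nat).
Proof.
rewrite eigval_S1 -zcos_lt_half -zcos_gtN1 pmulr_rlt0 //.
have := cos_geN1 (ang a); rewrite -/(zcos a); set c := zcos a => c1.
apply/idP/andP => [h|[h1 h2]]; last by nra.
by split; nra.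
Qed.

Lemma eigval_S2_gt0 a : (0 < eigval (S2 k) a) =
  if odd a then (k < 3 * a < 5 * k)%N && (a != k :> nat)
  else (3 * a < k)%N || (5 * k < 3 * a)%N.
Proof.
rewrite eigval_S2 -signr_odd -eigval_S1_gt0 -eigval_S1_lt0.
by case: odd; rewrite ?expr0 ?expr1 ?mul1r // mulN1r oppr_gt0.
Qed.

End EvenOrder.

(* Odd indices are shifted by the least even d with k <= 3 d away from 0, out of
   the arc where the eigenvalues of the first graph are positive and into the arc
   where they are negative; even indices stay put.  The index e is missed. *)
Lemma pos_eigenvalues_S1_lt_S2 (R : realType) (k : nat) : (6 <= k)%N ->
  (pos_eigenvalues (adjacency R (circulant (S1 k))) <
   pos_eigenvalues (adjacency R (circulant (S2 k))))%N.
Proof.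
move=> hk; have n1 : (1 < 2 * k)%N by lia.
rewrite (pos_eigenvalues_prod (char_poly_circulant R n1 (connection_set_S1 hk))).
rewrite (pos_eigenvalues_prod (char_poly_circulant R n1 (connection_set_S2 hk))).
set A := [set a | _]; set B := [set a | _].
have natK m : (m < 2 * k)%N -> (m%:R : 'Z_(2 * k)) = m :> nat.
  by move=> mn; rewrite val_Zp_nat // modn_small.
pose d := (2 * ((k + 5) %/ 6))%N.
have [d1 d2] : (k <= 3 * d)%N /\ (3 * d <= k + 5)%N by rewrite /d; lia.
have od : odd d = false by rewrite /d mul2n odd_double.
pose g (j : nat) := (if odd j then if j < k then j + d else j - d else j)%N.
(* For [k <> 7] this is the largest odd index below [k]; shifted indices below [k] are less than
   [(2 k + 5) / 3] and do not reach it. For [k = 7], [d = 4] sends 1 to 5, so 3 is taken instead. *)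
pose e := (if k == 7 then 3 else if odd k then k - 2 else k - 1)%N.
have eP : [\/ k = 7 /\ e = 3, k <> 7 /\ odd k /\ e = (k - 2)%N
            | ~~ odd k /\ e = (k - 1)%N].
  rewrite /e; case: (k =P 7) => [|k7]; first by constructor 1.
  by case: ifP => ok; [constructor 2 | constructor 3].
have oe : odd e by case: eP => [[_ ->]|[_ [? ->]]|[? ->]] //; lia.
have e2 : (e < 2 * k)%N by case: eP; lia.
clearbody d e.
have gA (a : 'Z_(2 * k)) : a \in A ->
    (g a < 2 * k)%N /\ odd (g a) = odd a.
  rewrite inE eigval_S1_gt0 // => ha; have := ltn_Zp a n1.
  rewrite /g; case: ifP => oa an; last by rewrite oa.
  by case: ifP => ak; split; lia.
have gB (a : 'Z_(2 * k)) : a \in A -> (g a)%:R \in B :\ (e%:R : 'Z_(2 * k)).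
  move=> aA; have [h1 h2] := gA a aA; have an := ltn_Zp a n1.
  rewrite !inE natZp_eq // eigval_S2_gt0 // natK // h2.
  move: aA; rewrite inE eigval_S1_gt0 // => ha.
  rewrite /g; case: (boolP (odd a)) => oa; last by lia.
  by case: ifP => ak; case: eP; lia.
have eB : (e%:R : 'Z_(2 * k)) \in B.
  rewrite inE eigval_S2_gt0 // natK // oe.
  by case: eP; lia.
rewrite (cardsD1 (e%:R : 'Z_(2 * k)) B) eB add1n ltnS.
pose f (a : 'Z_(2 * k)) : 'Z_(2 * k) := (g a)%:R.
rewrite -(@card_in_imset _ _ f A).
  by apply/subset_leq_card/subsetP => _ /imsetP[a aA ->]; apply: gB.
(* Injectivity: [g] preserves parity, and the odd indices coming from the two ends of the range land
   on opposite sides of [k]. *)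
move=> a b aA bA /eqP; have [a1 a2] := gA a aA; have [b1 b2] := gA b bA.
rewrite natZp_eq // => /eqP gab; apply/val_inj => /=.
have oab : odd a = odd b by rewrite -a2 -b2 gab.
have := ltn_Zp a n1; have := ltn_Zp b n1.
move: aA bA; rewrite !inE !eigval_S1_gt0 // => ha hb.
by move: gab; rewrite /g oab; case: odd => //; do 2!case: ifP; lia.
Qed.

Theorem theorem3p1 (R : realType) (k : nat) (hk : (6 <= k)%N) :
  inertia R (circulant (S1 k)) <> inertia R (circulant (S2 k)).
Proof.
by move=> [e _ _]; have := pos_eigenvalues_S1_lt_S2 R hk; rewrite e ltnn.
Qed.
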